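(* Let $G$ be a $3$-connected bipartite planar graph. Then $\overrightarrow{\chi}(G) \le 3$.
   Context: All graphs are finite and simple, with at least one vertex. An orientation $\sigma$ of $G$ is a digraph obtained from $G$ by replacing each edge by exactly one of the two possible arcs with the same end-vertices. For $v \in V(G)$, the indegree $d^-_{\sigma}(v)$ is the number of arcs of $\sigma$ incoming to $v$. A $k$-orientation is an orientation in which every vertex has indegree at most $k$. An orientation $\sigma$ is proper if $d^-_{\sigma}(u) \ne d^-_{\sigma}(v)$ for every edge $uv \in E(G)$. The proper orientation number $\overrightarrow{\chi}(G)$ is the minimum integer $k$ such that $G$ admits a proper $k$-orientation. *)

(* Defs.v *)
From HB Require Import structures.
From mathcomp Require Import all_boot all_order all_algebra.
From mathcomp Require Import classical_sets reals topology normedtype.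

Set Implicit Arguments.
Unset Strict Implicit.
Unset Printing Implicit Defensive.

Import Order.TTheory GRing.Theory Num.Theory.
Import numFieldNormedType.Exports.

Record sgraph := SGraph {
  vertex :> finType;
  adj : rel vertex;
  adj_sym : symmetric adj;
  adj_irr : irreflexive adj;
  vertex_gt0 : 0 < #|vertex| }.

Definition bipartite (G : sgraph) : Prop :=
  exists A : {set G}, forall x y : G, adj x y -> (x \in A) != (y \in A).

Definition connected_off (G : sgraph) (X : {set G}) : Prop :=
  forall x y : G, x \notin X -> y \notin X ->
    connect [rel u v | [&& adj u v, u \notin X & v \notin X]] x y.

Definition k_connected (k : nat) (G : sgraph) : Prop :=
  k < #|G| /\ forall X : {set G}, #|X| < k -> connected_off X.

Section Planarity.
Local Open Scope classical_set_scope.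
Local Open Scope ring_scope.

Definition arc_between (R : realType) (a b : R * R) (A : set (R * R)) : Prop :=
  exists g : R -> R * R,
    [/\ {within `[0, 1], continuous g},
        {in `[0, 1] &, injective g},
        g 0 = a, g 1 = b
      & A = g @` `[0, 1]].

(* [gam x y] is only meaningful when [x] and [y] are adjacent; [gam x y] and
   [gam y x] are then the drawing of one and the same edge. *)
Definition planar (R : realType) (G : sgraph) : Prop :=
  exists (pos : G -> R * R) (gam : G -> G -> set (R * R)),
    [/\ injective pos,
        forall x y, adj x y ->
          arc_between (pos x) (pos y) (gam x y) /\ gam x y = gam y x,
        forall x y z, adj x y -> gam x y (pos z) -> z = x \/ z = y
      & forall x y u v, adj x y -> adj u v ->
          (u, v) <> (x, y) -> (u, v) <> (y, x) ->
          forall q, gam x y q -> gam u v q -> exists z, q = pos z].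

End Planarity.

Section Orientation.
Variable G : sgraph.
Implicit Type D : {set G * G}.

(* [(x, y) \in D] is the arc from [x] to [y]. *)
Definition orientation D : bool :=
  [forall x, forall y, if adj x y then ((x, y) \in D) (+) ((y, x) \in D)
                       else (x, y) \notin D].

Definition indegree D (v : G) : nat := #|[set u | (u, v) \in D]|.

Definition proper D : bool :=
  [forall x, forall y, adj x y ==> (indegree D x != indegree D y)].

Definition has_proper_orientation (k : nat) : bool :=
  [exists D, [&& orientation D, proper D & [forall v, indegree D v <= k]]].

Local Lemma proper_orientation_on (S : {set G}) : exists D : {set G * G},
  [/\ forall x y, if [&& adj x y, x \in S & y \in S]
        then ((x, y) \in D) (+) ((y, x) \in D) else (x, y) \notin D
    & forall x y, adj x y -> x \in S -> y \in S -> indegree D x != indegree D y].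
Proof.
have [n] := ubnP #|S|; elim: n => // n IHn in S * => ltSn.
have [->|[v0 v0S]] := set_0Vmem S.
  by exists finset.set0; split=> x y; rewrite !inE ?andbF.
pose deg v := #|[set u in S | adj u v]|.
case: (arg_maxnP deg v0S) => v vS0 maxv; have {vS0}vS : v \in S := vS0.
have {IHn}/IHn [D [oD pD]] : #|S :\ v| < n by rewrite (cardsD1 v) vS in ltSn.
have Dsub x y : (x, y) \in D -> [&& adj x y, x \in S :\ v & y \in S :\ v].
  by move=> xyD; move: (oD x y); case: ifP => //; rewrite xyD.
have vD x : ((v, x) \in D) = false.
  by apply/negP => /Dsub; rewrite !inE eqxx /= andbF.
have Dv x : ((x, v) \in D) = false.
  by apply/negP => /Dsub; rewrite !inE eqxx /= !andbF.
pose D' := D :|: [set p | [&& p.2 == v, p.1 \in S & adj p.1 v]].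
have inD' x y : ((x, y) \in D') =
    ((x, y) \in D) || [&& y == v, x \in S & adj x v] by rewrite !inE.
have indv : indegree D' v = deg v.
  by apply: eq_card => u; rewrite !inE Dv eqxx.
have indx x : x != v -> indegree D' x = indegree D x.
  by move=> xv; apply: eq_card => u; rewrite !inE (negPf xv) orbF.
have ltv x : x != v -> adj x v -> x \in S -> indegree D' x < deg v.
  move=> xv axv xS; rewrite indx //; apply: leq_trans (maxv x xS).
  apply: proper_card; apply/fintype.properP; split.
    apply/fintype.subsetP => u; rewrite !inE => /Dsub; rewrite !inE.
    by case/and3P=> -> /andP[_ ->].
  by exists v; rewrite !inE ?vD // vS adj_sym.
exists D'; split=> [x y|x y axy xS yS].
  rewrite !inD'.
  have [->|xv] := eqVneq x v; have [->|yv] := eqVneq y v.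
  - by rewrite Dv adj_irr /= andbF.
  - by rewrite vD Dv adj_sym vS /=; case: (adj y v); case: (y \in S).
  - by rewrite vD Dv vS /=; case: (adj x v); case: (x \in S).
  by move: (oD x y); rewrite !inE xv yv /= !orbF.
have [ex|xv] := eqVneq x v; have [ey|yv] := eqVneq y v.
- by move: axy; rewrite ex ey adj_irr.
- by rewrite ex indv gtn_eqF // ltv // adj_sym -ex.
- by rewrite ey indv ltn_eqF // ltv // -ey.
by rewrite !indx // pD // !inE ?xv ?yv.
Qed.

Lemma ex_proper_orientation : exists k, has_proper_orientation k.
Proof.
have [D [oD pD]] := proper_orientation_on [set: G].
exists #|G|; apply/existsP; exists D; apply/and3P; split.
- by apply/forallP => x; apply/forallP => y; move: (oD x y); rewrite !inE !andbT.
- apply/forallP => x; apply/forallP => y; apply/implyP => axy.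
  by apply: pD; rewrite ?inE.
- by apply/forallP => v; apply: max_card.
Qed.

Definition proper_orientation_number : nat := ex_minn ex_proper_orientation.

End Orientation.

(* Main.v *)
Require Import Defs.
From mathcomp Require Import classical_sets reals topology normedtype.
From mathcomp Require Import all_boot all_order all_algebra.
From mathcomp Require Import ring lra zify.

Set Implicit Arguments.
Unset Strict Implicit.
Unset Printing Implicit Defensive.

(** Let A be one side of the bipartition. The orientation that is built gives
    every vertex of A indegree exactly 3 and every other vertex indegree at most
    2; since all edges join the two sides, it is proper. To specify it is to
    choose, for each a in A, three edges that enter a, so that each vertex b
    outside A keeps at most two edges that no neighbour of b has chosen. Every
    degree is at least 3 by 3-connectivity, so choices exist, and an
    alternating path argument ([ex_forced_orientation]) produces a good one as
    soon as every vertex set S spans at most 2 |S| edges.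

    That bound is Euler's inequality e <= 2n - 4 for bipartite planar graphs.
    The drawing consists of arbitrary continuous arcs, and what is extracted from
    it is a parity.
    Take two disjoint arcs p and q and look at the map (s, t) |-> p s - q t from
    the square to the punctured plane: its winding along the boundary of the
    square vanishes. The four sides of the square see one arc from an end of the
    other. So if K e v is the parity of the number of times that the arc of e
    crosses a fixed ray from v, then K e c + K e d + K f a + K f b is, for
    disjoint edges e = ab and f = cd, a function of the order in which the four
    points lie in the plane ([winding_swap], [planar_even_drawing]). It is the
    statement that the van Kampen obstruction modulo 2 vanishes; below it is
    taken as the definition of an even drawing.

    Even drawings behave like planar graphs as far as is needed. They are
    inherited by subgraphs, and by the graph obtained when two neighbours a1, a2
    of a vertex b are identified and b is deleted ([even_merge]), because the
    parity of a path is the sum of the parities of its edges. They rule out a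
    K_{3,3} in which one vertex may be replaced by a connected set
    ([no_even_K33]): adding up the relations of all 18 pairs of disjoint edges
    gives 0 = 1.

    This suffices for |D| + 4 <= 2 |S| ([sparse_even_bipartite]), by induction.
    In a minimal counterexample |D| = 2 |S| - 3, so some vertex b has degree at
    most 3, and exactly 3 because a vertex of degree at most 2 can be deleted.
    Let a1, a2, a3 be its neighbours. If a1 and a2 have at most one common
    neighbour besides b, then deleting b and identifying a1 with a2 removes two
    vertices and at most four edges, and leaves a smaller counterexample.
    Otherwise let c and c' be two further common neighbours and let X be the
    component of a3 in the graph without a1, a2, b, c, c'. If X has edges to
    both c and c', then a1, a2, X and b, c, c' form a K_{3,3}. If X has no edge
    to c', say, then the graph is the union of two smaller graphs that share
    exactly the path a1 c a2, and the bounds for both parts add up to the bound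
    for the whole ([link_or_split]). *)

(** * Counting edges by an end *)

Section PairCounting.
Variable V : finType.
Implicit Types D : {set V * V}.

Lemma card_swap D : #|[set p | (p.2, p.1) \in D]| = #|D|.
Proof.
pose sw (p : V * V) := (p.2, p.1).
have swI : injective sw by move=> [x y] [u v] [-> ->].
rewrite -(card_imset _ swI); apply: eq_card => -[x y].
apply/imsetP/idP => [[[u v] + [-> ->]]|xyD]; first by rewrite inE.
by exists (y, x); rewrite ?inE.
Qed.

Lemma card_fiber2 D b : #|[set p in D | p.2 == b]| = #|[set a | (a, b) \in D]|.
Proof.
have inj : injective (fun a : V => (a, b)) by move=> a a' [].
rewrite -(card_imset _ inj); apply: eq_card => -[x y]; rewrite !inE /=.
apply/andP/imsetP => [[xyD /eqP <-]|[a]]; first by exists x; rewrite ?inE.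
by rewrite inE => abD [-> ->]; rewrite eqxx.
Qed.

Lemma card_fibers2 D (B : {set V}) :
  #|[set p in D | p.2 \in B]| = \sum_(b in B) #|[set a | (a, b) \in D]|.
Proof.
rewrite -sum1_card (partition_big snd (mem B)) /=; last first.
  by move=> p; rewrite inE => /andP [].
apply: eq_bigr => b bB; rewrite -card_fiber2 -sum1_card; apply: eq_bigl => p.
by rewrite !inE -andbA; case: eqP => [->|_]; rewrite ?bB ?andbF.
Qed.

Lemma card_fibers1 D (B : {set V}) :
  #|[set p in D | p.1 \in B]| = \sum_(a in B) #|[set b | (a, b) \in D]|.
Proof.
rewrite -card_swap; under [RHS]eq_bigr => a _.
  have -> : [set b | (a, b) \in D] =
      [set b | (b, a) \in [set p | (p.2, p.1) \in D]].
    by apply/setP => b; rewrite !inE.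
over.
by rewrite -card_fibers2; apply: eq_card => -[x y]; rewrite !inE.
Qed.

End PairCounting.

(** * Choosing k incoming edges at every vertex of one side *)

Section ForcedOrientation.
Variables (V : finType) (E : {set V * V}) (A : {set V}) (k m : nat).
Implicit Types (F : {set V * V}) (p : seq V).

(** An orientation is encoded by the set F of edges directed towards their end
    in A; the remaining edges point to the other side. *)
Definition admissible F :=
  (F \subset E) && [forall a in A, #|[set b | (a, b) \in F]| == k].

Definition kept F b := #|[set a | (a, b) \in E :\: F]|.

Definition swappable F : rel V :=
  [rel x y | [exists a, ((a, x) \in E :\: F) && ((a, y) \in F)]].

(** When a gives up the edge to y and takes the one to x instead, the indegree
    of x drops by one and that of y grows by one. The equation is phrased with
    [b == x] and [b == y] as summands to avoid truncated subtraction and to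
    compose along a path. *)
Lemma swap_choice F a x y : admissible F -> (a, x) \in E :\: F ->
  (a, y) \in F -> let F' := (a, x) |: F :\ (a, y) in
  admissible F' /\ forall b, kept F' b + (b == x) = kept F b + (b == y).
Proof.
move=> /andP [FE /forall_inP rk]; rewrite inE => /andP [xF xE] yF F'.
have xy : x != y by apply: contraNneq xF => ->.
have inF' a' b : (a', b) \in F' =
    ((a', b) == (a, x)) || (((a', b) != (a, y)) && ((a', b) \in F)).
  by rewrite in_setU1 in_setD1.
split.
  apply/andP; split.
    apply/subsetP => p /setU1P [->//|/setD1P [_]]; exact: (subsetP FE).
  apply/forall_inP => a' /rk /eqP <-; apply/eqP.
  have [->|aa'] := eqVneq a' a; last first.
    by apply: eq_card => b; rewrite inE inF' !xpair_eqE (negPf aa') inE.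
  set r := [set b | (a, b) \in F].
  have -> : [set b | (a, b) \in F'] = x |: r :\ y.
    apply/setP => b.
    by rewrite [LHS]inE inF' in_setU1 in_setD1 inE !xpair_eqE eqxx.
  have -> : #|r| = #|r :\ y|.+1 by rewrite (cardsD1 y) inE yF.
  by rewrite cardsU1 !inE (negPf xF) andbF.
move=> b; rewrite /kept.
set c := [set a | (a, b) \in E :\: F].
have cE : [set a | (a, b) \in E :\: F'] =
    if b == x then c :\ a else if b == y then a |: c else c.
  apply/setP => a'; rewrite inE in_setD inF' !xpair_eqE.
  have [bx|bx] := eqVneq b x.
    by rewrite in_setD1 inE in_setD bx (negPf xy) andbF andbT /= negb_or andbA.
  have [bY|bY] := eqVneq b y; last by rewrite !andbF /= !inE.
  rewrite in_setU1 inE in_setD bY andbF andbT /= negb_and negbK.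
  by case: eqP => [->|] //=; rewrite (subsetP FE).
rewrite cE; have [bx|bx] := eqVneq b x.
  by rewrite bx (negPf xy) addn0 (cardsD1 a c) inE in_setD bx xF xE addnC.
have [bY|bY] := eqVneq b y; rewrite !addn0 //.
by rewrite cardsU1 inE in_setD bY yF addnC.
Qed.

(** Swaps made one after the other along a simple path transport one
    unit of indegree from x to [last x p]. Simplicity ensures that a swap does
    not spoil the later ones. *)
Lemma shift_kept F x p : admissible F -> path (swappable F) x p ->
  uniq (x :: p) -> exists2 F', admissible F' &
  forall b, kept F' b + (b == x) = kept F b + (b == last x p).
Proof.
elim: p x F => [|y p IHp] x F adF /=; first by exists F.
case/andP=> /existsP [a /andP [ax ay]] ppath /andP [xyp yp].
have [adF1 in1] := swap_choice adF ax ay; set F1 := _ |: _ in adF1 in1.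
have xp : x \notin p by move: xyp; rewrite inE negb_or => /andP [].
(* The first swap only alters edges at x and y, which s avoids. *)
have keep z s : z != x -> x \notin s -> y \notin s ->
    path (swappable F) z s -> path (swappable F1) z s.
  elim: s z => //= u s IHs z zx; rewrite !inE !negb_or.
  move=> /andP [xu xs] /andP [yu ys] /andP [zu us].
  rewrite IHs 1?eq_sym ?andbT //.
  have /existsP [a' /andP [/setDP [zE zF] uF]] := zu; apply/existsP; exists a'.
  rewrite in_setD !in_setU1 !in_setD1 !xpair_eqE zE (negPf zF) uF (negPf zx).
  by rewrite (eq_sym u y) (negPf yu) !andbF orbT.
have p1 : path (swappable F1) y p.
  apply: keep => //; last by case/andP: yp.
  by move: xyp; rewrite inE negb_or eq_sym => /andP [].
have [F' adF' in'] := IHp _ _ adF1 p1 yp.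
exists F' => // b; move: (in1 b) (in' b); move: (kept F1 b); lia.
Qed.

Hypothesis bipE : forall a b, (a, b) \in E -> (a \in A) && (b \notin A).
Hypothesis degA : forall a, a \in A -> k <= #|[set b | (a, b) \in E]|.
Hypothesis sparse : forall S, #|E :&: setX S S| <= m * #|S|.
Hypothesis mk : m <= k.

Lemma ex_admissible : exists F, admissible F.
Proof.
pose T a := [set b in take k (enum [set b | (a, b) \in E])].
exists [set p in E | p.2 \in T p.1]; apply/andP; split.
  by apply/subsetP => p; rewrite inE => /andP [].
apply/forall_inP => a aA; apply/eqP.
have -> : [set b | (a, b) \in [set p in E | p.2 \in T p.1]] = T a.
  apply/setP => b; rewrite !inE /=; apply: andb_idl => /mem_take.
  by rewrite mem_enum inE.
rewrite cardsE (card_uniqP _) ?take_uniq ?enum_uniq // size_takel //.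
by rewrite -cardE degA.
Qed.

(** Let B be the set of vertices that can be reached from b0, and C the set of
    their neighbours along kept edges. Every edge kept at B ends in C, and every
    edge chosen by C ends in B. If all of B kept at least m edges, B and C
    together would span more than m |B| + k |C| edges. *)
Lemma reach_low F b0 : admissible F -> m < kept F b0 ->
  exists2 b, connect (swappable F) b0 b & kept F b < m.
Proof.
move=> /andP [FE /forall_inP rk] b0m.
apply/exists_inP; apply: contraT; rewrite negb_exists_in => /forall_inP high.
pose B := [set b | connect (swappable F) b0 b].
pose C := [set a in A | [exists b in B, (a, b) \in E :\: F]].
have b0B : b0 \in B by rewrite inE connect0.
have cB : m * #|B| < #|[set p in E :\: F | p.2 \in B]|.
  rewrite card_fibers2 (bigD1 b0) //= (cardsD1 b0) b0B mulnDr muln1.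
  rewrite -addSn leq_add // mulnC -sum_nat_const.
  rewrite [X in _ <= X](eq_bigl (mem (B :\ b0))); last first.
    by move=> b; rewrite !inE andbC.
  by apply: leq_sum => b /setD1P [_]; rewrite inE => /high; rewrite -leqNgt.
have cC : #|[set p in F | p.1 \in C]| = k * #|C|.
  rewrite card_fibers1 mulnC -sum_nat_const; apply: eq_bigr => a.
  by rewrite inE => /andP [/rk /eqP].
have disj : [set p in E :\: F | p.2 \in B] :&: [set p in F | p.1 \in C] = set0.
  by apply/setP => p; rewrite !inE; case: (p \in F); rewrite ?andbF.
have : [set p in E :\: F | p.2 \in B] :|: [set p in F | p.1 \in C] \subset
    E :&: setX (B :|: C) (B :|: C).
  apply/subsetP => -[a b]; rewrite in_setU in_setI in_setX !in_setU.
  case/orP; rewrite inE => /andP [].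
    move=> abE /= bB; rewrite bB; have /setDP [-> _] := abE; rewrite andbT /=.
    rewrite orbC inE; have /setDP [/bipE /andP [-> _] _] := abE.
    by apply/orP; left; apply/exists_inP; exists b.
  move=> abF /= aC; rewrite aC orbT (subsetP FE) //=; apply/orP; left.
  move: aC; rewrite inE => /andP [_ /exists_inP [b']].
  rewrite !inE => b0b' ab'; apply: connect_trans b0b' _; apply: connect1.
  by apply/existsP; exists a; rewrite abF inE ab'.
move/subset_leq_card; rewrite cardsU disj cards0 subn0 cC => leE.
have := leq_trans leE (sparse _); rewrite leqNgt => /negP; case.
apply: leq_ltn_trans (_ : m * (#|B| + #|C|) < _).
  by apply: leq_mul => //; rewrite cardsU leq_subr.
by rewrite mulnDr -addSn leq_add // leq_mul2r mk orbT.
Qed.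

(** A choice with the least total excess over m has no excess: an overloaded
    vertex could be relieved at the expense of a vertex with room to spare. *)
Theorem ex_forced_orientation : exists F, [/\ F \subset E,
  forall a, a \in A -> #|[set b | (a, b) \in F]| = k &
  forall b, #|[set a | (a, b) \in E :\: F]| <= m].
Proof.
have [F0 adF0] := ex_admissible.
pose excess F := \sum_b (kept F b - m).
case: (arg_minnP excess adF0) => F adF minF; exists F.
case/andP: (adF) => FE /forall_inP rk; split=> // [a /rk /eqP //|b0].
rewrite leqNgt; apply/negP => b0m.
have [b1 /connectP [p pp eb1] b1m] := reach_low adF b0m.
case/shortenP: pp eb1 => p' pp' up' _ eb1.
have [F' adF' in'] := shift_kept adF pp' up'.
have := minF F' adF'; rewrite leqNgt => /negP; apply.
have b01 : b0 != b1 by apply: contraTneq b1m => <-; rewrite -leqNgt ltnW.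
rewrite -eb1 in in'.
rewrite /excess (bigD1 b0) //= [X in _ < X](bigD1 b0) //=.
have := in' b0; rewrite eqxx (negPf b01).
suff : \sum_(i | i != b0) (kept F' i - m) <=
    \sum_(i | i != b0) (kept F i - m).
  by move: b0m; rewrite /kept; lia.
apply: leq_sum => b bb0; have := in' b; rewrite (negPf bb0).
have [->|_] := eqVneq b b1; last by rewrite !addn0 => ->.
by move: b1m; rewrite /kept; lia.
Qed.

End ForcedOrientation.

(** * Even drawings and K_{3,3} *)

Section EvenDrawing.
Variables (V : finType) (L : V -> V -> bool).
Implicit Types (A S X : {set V}) (D : {set V * V}) (K : V -> V -> V -> bool).

(** [L u v] tells on which side of v the point u lies in a fixed linear order of
    the plane, and [K c d v] is the parity with which the arc of the edge cd
    turns around v. Seen from the arc, the point v turns around it with parity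
    [pot K c d v]: the correction by L accounts for the reversal of direction.
    As a function of v, [pot K c d] is thus the potential whose differences
    count the crossings of cd with a path. *)
Definition pot K c d v := K c d v (+) (L c v (+) L d v).

Definition even_pair K a b c d :=
  K a b c (+) K a b d = pot K c d a (+) pot K c d b.

(** Edges are directed from A to its complement, which makes [a != c] and
    [b != d] say that the edges ab and cd are disjoint. *)
Definition even_drawing D K := forall a b c d,
  (a, b) \in D -> (c, d) \in D -> a != c -> b != d -> even_pair K a b c d.

(** S is a vertex set that carries D, and may contain isolated vertices. *)
Definition bip A S D := D \subset setX (S :&: A) (S :\: A).

Lemma bipP A S D a b : bip A S D -> (a, b) \in D ->
  [/\ a \in S, a \in A, b \in S & b \notin A].
Proof.
by move/subsetP=> /[apply]; rewrite !inE /= => /andP[/andP[-> ->] /andP[-> ->]].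
Qed.

Lemma even_drawingS D' D K : D' \subset D -> even_drawing D K ->
  even_drawing D' K.
Proof.
by move=> /subsetP sD ev a b c d /sD abD /sD cdD; apply: ev.
Qed.

Hypothesis Lanti : forall u v, u != v -> L v u = ~~ L u v.

Lemma even_pair_sym K a b c d : a != c -> a != d -> b != c -> b != d ->
  even_pair K a b c d -> even_pair K c d a b.
Proof.
move=> ac ad bc bd; rewrite /even_pair /pot.
rewrite (Lanti ac) (Lanti ad) (Lanti bc) (Lanti bd).
by case: (K a b c); case: (K a b d); case: (K c d a); case: (K c d b);
  case: (L a c); case: (L a d); case: (L b c); case: (L b d).
Qed.

Lemma even_drawing_swap D K : even_drawing D K ->
  even_drawing [set p | (p.2, p.1) \in D] (fun a b => K b a).
Proof.
move=> ev a b c d; rewrite !inE /= => abD cdD ac bd.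
have := ev _ _ _ _ abD cdD bd ac; rewrite /even_pair /pot addbC => ->.
by rewrite addbC (addbC (L d a)) (addbC (L d b)).
Qed.

Lemma bip_swap A S D : bip A S D -> bip (~: A) S [set p | (p.2, p.1) \in D].
Proof.
move=> bD; apply/subsetP => -[x y]; rewrite inE => /(bipP bD) [yS yA xS xA].
by rewrite !inE /= xS xA yS yA.
Qed.

(** Linear algebra modulo 2 is done by [ring] on bool, where 2 = 0 is not built
    in: q is the half of the even part. *)
Lemma xor_eq (x y s q : bool) : s = false -> (x + y + s = q + q)%R -> x = y.
Proof. by move=> ->; rewrite /GRing.add /=; case: x y q => [] [] []. Qed.

(** In K_{3,3}, the 4-cycle through a1, a2 and two of the b's winds around a3
    and around the third b with the same parity, since the edge from a3 to that
    b avoids the cycle. Here x1, x2, y, y' are the parities of that edge at the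
    vertices of the cycle, p, q, p', q' are potentials at a3, and the remaining
    terms make up the potentials at the third b. *)
Lemma odd_link (x1 x2 y y' p q p' q' k1 k2 k1' k2' l1 l2 m m' : bool) :
  x1 (+) y = p (+) (k1 (+) (l1 (+) m)) -> x2 (+) y = q (+) (k2 (+) (l2 (+) m)) ->
  x1 (+) y' = p' (+) (k1' (+) (l1 (+) m')) ->
  x2 (+) y' = q' (+) (k2' (+) (l2 (+) m')) ->
  (p (+) q) (+) (p' (+) q') = (k1 (+) k2) (+) (k1' (+) k2').
Proof.
pose s := ((x1 (+) y) (+) (x2 (+) y) (+) ((x1 (+) y') (+) (x2 (+) y'))).
move=> e1 e2 e3 e4; have s0 : s = false.
  by rewrite /s; case: (x1) (x2) (y) (y') => [] [] [] [].
rewrite /s e1 e2 e3 e4 in s0; apply: (xor_eq s0).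
instantiate (1 := (p + q + p' + q' + k1 + k2 + k1' + k2' + l1 + l2 + m + m')%R).
by rewrite -[addb]/(+%R : bool -> bool -> bool) /=; ring.
Qed.

(** The contradiction for K_{3,3}. The first three equations come from
    [odd_link], and in their sum the contributions s1, s2, s3 of a3 cancel. The
    others are the relations of the pairs a1 bj, a2 bk: there xjk and yjk stand
    for the parity of a1 bj, respectively a2 bj, at bk. The sum of everything
    cancels except for the three values of L that occur together with their
    negation. *)
Lemma odd_crossings (s1 s2 s3 u1 u2 u3 p1 p2 p3 z1 z2 z3 : bool)
    (x12 x13 x23 x21 x31 x32 y12 y13 y23 y21 y31 y32 l12 l13 l23 : bool) :
  s2 (+) s3 = (x21 (+) y21) (+) (x31 (+) y31) ->
  s1 (+) s3 = (x12 (+) y12) (+) (x32 (+) y32) ->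
  s1 (+) s2 = (x13 (+) y13) (+) (x23 (+) y23) ->
  u1 (+) x12 = p2 (+) (y21 (+) (z1 (+) (true (+) l12))) ->
  u1 (+) x13 = p3 (+) (y31 (+) (z1 (+) (true (+) l13))) ->
  u2 (+) x23 = p3 (+) (y32 (+) (z2 (+) (true (+) l23))) ->
  u2 (+) x21 = p1 (+) (y12 (+) (z2 (+) l12)) ->
  u3 (+) x31 = p1 (+) (y13 (+) (z3 (+) l13)) ->
  u3 (+) x32 = p2 (+) (y23 (+) (z3 (+) l23)) -> False.
Proof.
have hx (x y : bool) : x = y -> x (+) y = false by move=> ->; apply: addbb.
have h2 (x y : bool) : x = false -> y = false -> x (+) y = false.
  by move=> -> ->.
move=> /hx e1 /hx e2 /hx e3 /hx e4 /hx e5 /hx e6 /hx e7 /hx e8 /hx e9.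
have s0 := h2 _ _ e1 (h2 _ _ e2 (h2 _ _ e3 (h2 _ _ e4 (h2 _ _ e5
  (h2 _ _ e6 (h2 _ _ e7 (h2 _ _ e8 e9))))))).
suff : true = false by [].
apply: (xor_eq s0); instantiate (1 := (s1 + s2 + s3 + u1 + u2 + u3 + p1 + p2 + p3
 + z1 + z2 + z3 + x12 + x13 + x23 + x21 + x31 + x32 + y12 + y13 + y23 + y21
 + y31 + y32 + l12 + l13 + l23 + 1 + 1)%R).
rewrite -[addb]/(+%R : bool -> bool -> bool) /=.
by rewrite -[true]/(1 : bool)%R -[false]/(0 : bool)%R; ring.
Qed.

(** No even drawing contains a K_{3,3} with sides a1, a2, a3 and b1, b2, b3. The
    edges at a3 are virtual: each is given by a parity function T that behaves
    like that of an arc from a3 to d, as the sum over a path does. *)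
Lemma no_even_K33 (a1 a2 a3 b1 b2 b3 : V) K :
  let b := [:: b1; b2; b3] in b1 != b2 -> b1 != b3 -> b2 != b3 ->
  {in b &, forall d d', d != d' -> even_pair K a1 d a2 d'} ->
  {in b, forall d, exists T : V -> bool, forall a d', a \in [:: a1; a2] ->
     d' \in b -> d != d' -> T a (+) T d' = pot K a d' a3 (+) pot K a d' d} ->
  False.
Proof.
move=> b n12 n13 n23 H12 H3.
have odd_avoid : forall d d' d'', d \in b -> d' \in b -> d'' \in b ->
    d != d' -> d != d'' ->
    (pot K a1 d' a3 (+) pot K a2 d' a3) (+)
    (pot K a1 d'' a3 (+) pot K a2 d'' a3) =
    (K a1 d' d (+) K a2 d' d) (+) (K a1 d'' d (+) K a2 d'' d).
  move=> d d' d'' bd bd' bd'' dd' dd''; have [T HT] := H3 d bd.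
  have in1 : a1 \in [:: a1; a2] by rewrite inE eqxx.
  have in2 : a2 \in [:: a1; a2] by rewrite !inE eqxx orbT.
  exact: odd_link (HT _ _ in1 bd' dd') (HT _ _ in2 bd' dd')
    (HT _ _ in1 bd'' dd'') (HT _ _ in2 bd'' dd'').
have [i1 i2 i3] : [/\ b1 \in b, b2 \in b & b3 \in b].
  by split; rewrite !inE eqxx ?orbT.
have [n21 n31 n32] : [/\ b2 != b1, b3 != b1 & b3 != b2].
  by split; rewrite eq_sym.
have e1 := odd_avoid _ _ _ i1 i2 i3 n12 n13.
have e2 := odd_avoid _ _ _ i2 i1 i3 n21 n23.
have e3 := odd_avoid _ _ _ i3 i1 i2 n31 n32.
move: (H12 _ _ i2 i1 n21) (H12 _ _ i3 i1 n31) (H12 _ _ i3 i2 n32).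
move: (H12 _ _ i1 i2 n12) (H12 _ _ i1 i3 n13) (H12 _ _ i2 i3 n23).
rewrite /even_pair {2 4 6 8 10 12}/pot.
rewrite (Lanti n12) (Lanti n13) (Lanti n23) -!addTb.
exact: odd_crossings e1 e2 e3.
Qed.

Definition off D (F : {set V}) : rel V :=
  [rel u v | [&& ((u, v) \in D) || ((v, u) \in D), u \notin F & v \notin F]].

(** T is the sum of the parities of the edges of a path from x to y; the
    potentials at its interior vertices cancel. *)
Lemma connect_link D K F x y : even_drawing D K -> connect (off D F) x y ->
  exists T : V -> bool, forall c d, (c, d) \in D -> c \in F -> d \in F ->
    T c (+) T d = pot K c d x (+) pot K c d y.
Proof.
move=> ev /connectP [s]; elim: s x => [|z s IHs] x /=.
  by move=> _ ->; exists (fun=> false) => c d _ _ _; rewrite !addbb.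
case/andP=> /and3P [xz xF zF] /IHs /[apply] -[T HT].
exists (fun v => T v (+) (if (x, z) \in D then K x z v else K z x v)).
move=> c d cdD cF dF.
have neqF u v : u \notin F -> v \in F -> u != v.
  by move=> uF; apply: contraTneq => <-.
rewrite addbACA HT //.
suff -> : (if (x, z) \in D then K x z c else K z x c) (+)
    (if (x, z) \in D then K x z d else K z x d) = pot K c d x (+) pot K c d z.
  by rewrite addbC -addbA addKb.
case: ifP xz => [xzD _ | _ /= zxD]; first by apply: ev; rewrite ?neqF.
by rewrite (addbC (pot _ _ _ x)); apply: ev; rewrite ?neqF.
Qed.

(** Deletion of b and identification of a2 with a1. When b is a common neighbour
    of both, an edge of a2 can be redrawn from a1 along a1 b a2, which yields
    [Kmerge]. *)
Definition merge D a1 a2 b := [set p | [&& p.2 != b, p.1 != a2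
  & (p \in D) || (p.1 == a1) && ((a2, p.2) \in D)]].

Definition Kmerge D K a1 a2 b x y v :=
  if (x == a1) && ((x, y) \notin D) then K a2 y v (+) (K a1 b v (+) K a2 b v)
  else K x y v.

Lemma even_merge A S D K a1 a2 b : bip A S D -> even_drawing D K ->
  a1 != a2 -> (a1, b) \in D -> (a2, b) \in D ->
  even_drawing (merge D a1 a2 b) (Kmerge D K a1 a2 b).
Proof.
move=> bD ev a12 a1b a2b.
have mergeD x y : x != a1 -> (x, y) \in merge D a1 a2 b -> (x, y) \in D.
  by move=> /negPf xa1; rewrite inE /= xa1 orbF => /and3P[].
(* The relation holds when the first of the two edges is at a1; by symmetry
   this leaves only pairs of edges that were not redrawn. *)
have half y x' y' : (a1, y) \in merge D a1 a2 b -> (x', y') \in merge D a1 a2 b ->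
    a1 != x' -> y != y' -> even_pair (Kmerge D K a1 a2 b) a1 y x' y'.
  move=> a1y x'y' ax' yy'; have x'a : x' != a1 by rewrite eq_sym.
  have x'y'D := mergeD _ _ x'a x'y'.
  move: a1y x'y'; rewrite !inE /= eqxx /= => /and3P [yb _ H] /and3P[y'b x'a2 _].
  have potE v : pot (Kmerge D K a1 a2 b) x' y' v = pot K x' y' v.
    by rewrite /pot /Kmerge (negPf x'a).
  rewrite /even_pair !potE /Kmerge eqxx /=.
  case: ifPn => [nD|/negbNE a1y]; last exact: ev.
  rewrite (negPf nD) /= in H.
  have e1 := ev _ _ _ _ H x'y'D _ yy'; have e2 := ev _ _ _ _ a1b x'y'D ax' _.
  have e3 := ev _ _ _ _ a2b x'y'D _ _.
  rewrite addbACA (addbACA (K a1 b x')) e1 ?e2 ?e3 1?eq_sym //.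
  by case: (pot _ _ _ a2) (pot _ _ _ b) (pot _ _ _ y) (pot _ _ _ a1)
    => [] [] [] [].
move=> x y x' y' xyD x'y'D xx' yy'.
have inSA u v : (u, v) \in merge D a1 a2 b -> (u \in A) && (v \notin A).
  rewrite inE /= => /and3P [_ _ /orP [/(bipP bD) [_ -> _ ->] //|]].
  move=> /andP [/eqP -> /(bipP bD)].
  by case: (bipP bD a1b) => _ -> _ _ [_ _ _ ->].
have neqA u v : u \in A -> v \notin A -> u != v.
  by move=> uA; apply: contraNneq => <-.
have [ex|xa] := eqVneq x a1; first by move: xyD xx'; rewrite ex => *; apply: half.
have [ex'|x'a] := eqVneq x' a1.
  move: x'y'D xx'; rewrite ex' => x'y'D xx'.
  have /andP [xA yA] := inSA _ _ xyD; have /andP [x'A y'A] := inSA _ _ x'y'D.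
  have := half _ _ _ x'y'D xyD; rewrite eq_sym xx' eq_sym yy' => /(_ isT isT).
  have [n1 n2] := (neqA _ _ x'A yA, neqA _ _ xA y'A).
  by apply: even_pair_sym; rewrite // eq_sym.
rewrite /even_pair /pot /Kmerge (negPf xa) (negPf x'a) /=.
by apply: ev => //; apply: mergeD.
Qed.

(** * Euler's inequality for even bipartite drawings *)

Lemma card_bip A S D : bip A S D -> #|D| <= #|S :&: A| * #|S :\: A|.
Proof. by move/subset_leq_card; rewrite cardsX. Qed.

Lemma bip_low_degree A S D : bip A S D -> #|D| < 2 * #|S| ->
  exists2 v, v \in S &
    #|[set p in D | p.2 == v]| + #|[set p in D | p.1 == v]| <= 3.
Proof.
move=> bD ltDS; apply/exists_inP; apply: contraLR ltDS.
rewrite negb_exists_in -leqNgt => /forall_inP deg4.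
have cD (f : V * V -> V) : (forall p, p \in D -> f p \in S) ->
    \sum_(v in S) #|[set p in D | f p == v]| = #|D|.
  move=> fS; rewrite -sum1_card (partition_big f (mem S)) //=.
  by apply: eq_bigr => v vS; rewrite -sum1_card; apply: eq_bigl => p; rewrite inE.
have : \sum_(v in S) 4 <= \sum_(v in S)
    (#|[set p in D | p.2 == v]| + #|[set p in D | p.1 == v]|).
  by apply: leq_sum => v vS; rewrite ltnNge deg4.
rewrite sum_nat_const big_split /= !cD.
- by rewrite mulnC addnn -muln2; move: #|S| #|D| => s d; lia.
- by move=> [x y] /(bipP bD) [].
by move=> [x y] /(bipP bD) [].
Qed.

(** The lost edges are those at b, and one of the two edges to each common
    neighbour of a1 and a2 other than b; the latter is why < holds. *)
Lemma card_merge D a1 a2 b : a1 != a2 -> (a1, b) \in D -> (a2, b) \in D ->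
  #|D| < #|merge D a1 a2 b| + #|[set a | (a, b) \in D]|
         + #|[set y | ((a1, y) \in D) && ((a2, y) \in D)]|.
Proof.
move=> a12 a1b a2b; rewrite -(card_fiber2 D b).
set C := [set y | ((a1, y) \in D) && ((a2, y) \in D)]; set M := merge _ _ _ _.
set Fb := [set p in D | p.2 == b].
have bC : b \in C by rewrite inE a1b.
(* Y consists of the edges of a2 that become parallel to an edge of a1. *)
pose Y := [set p in D | [&& p.2 != b, p.1 == a2 & (a1, p.2) \in D]].
have leY : #|Y| <= #|C :\ b|.
  apply: leq_trans (leq_imset_card (fun y => (a2, y)) _); apply: subset_leq_card.
  apply/subsetP => -[x y]; rewrite inE /= => /and4P [xyD yb /eqP ex a1y].
  by rewrite -ex; apply: imset_f; rewrite !inE yb a1y -ex.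
pose Z := (D :\: Fb) :\: Y.
pose f (p : V * V) := (if p.1 == a2 then a1 else p.1, p.2).
have inZ x y : (x, y) \in Z ->
    [/\ (x, y) \in D, y != b & x = a2 -> (a1, y) \notin D].
  rewrite !inE /= => /and3P [+ + xyD]; rewrite xyD /= => + yb; rewrite yb /=.
  by move=> H; split=> // ex; move: H; rewrite ex eqxx.
have fI : {in Z &, injective f}.
  move=> [x y] [x' y'] /inZ [xyD yb H] /inZ [xyD' yb' H'].
  rewrite /f /= => -[ex ey]; subst y'; move: ex.
  case: eqVneq => [ex|_]; case: eqVneq => [ex'|_]; first by rewrite ex ex'.
  - by move=> e; move: (H ex); rewrite e xyD'.
  - by move=> e; move: (H' ex'); rewrite -e xyD.
  by move=> ->.
have leZ : #|Z| <= #|M|.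
  rewrite -(card_in_imset fI); apply: subset_leq_card.
  apply/subsetP => _ /imsetP [[x y] /inZ [xyD yb H] ->]; rewrite inE /f /= yb.
  have [ex|xa2] := eqVneq x a2; last by rewrite xa2 xyD.
  by rewrite a12 eqxx -ex xyD orbT.
have := cardsID Fb D; have := cardsID Y (D :\: Fb); rewrite -/Z.
have := subset_leq_card (subsetIr D Fb).
have := subset_leq_card (subsetIr (D :\: Fb) Y).
have := cardsD1 b C; rewrite bC.
by lia.
Qed.

Lemma bip_merge A S D a1 a2 b : bip A S D -> (a1, b) \in D -> (a2, b) \in D ->
  a1 != a2 -> bip A (S :\ b :\ a2) (merge D a1 a2 b).
Proof.
move=> bD a1b a2b a12; have [a1S a1A bS bA] := bipP bD a1b.
have [a2S a2A _ _] := bipP bD a2b.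
apply/subsetP => -[x y]; rewrite inE /= => /and3P [yb xa2 H].
have [xS xA yS yA] : [/\ x \in S, x \in A, y \in S & y \notin A].
  by case/orP: H => [/(bipP bD)//|/andP [/eqP-> /(bipP bD)[]]].
rewrite !inE /= yb xa2 xS xA yS yA /= !andbT.
by apply/andP; split; [apply: contraNneq bA => <-|apply: contraNneq yA => ->].
Qed.

Lemma leq_card_merge D a1 a2 b : #|merge D a1 a2 b| <= #|D|.
Proof.
pose f (p : V * V) := (if p.1 == a2 then a1 else p.1, p.2).
apply: leq_trans (leq_imset_card f D); apply: subset_leq_card.
apply/subsetP => -[x y]; rewrite inE /= => /and3P [_ xa2 /orP [xyD|]].
  by apply/imsetP; exists (x, y); rewrite // /f /= (negPf xa2).
case/andP=> /eqP -> a2y; apply/imsetP; exists (a2, y); rewrite // /f /= eqxx //.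
Qed.

(** The induction hypothesis of [sparse_even_bipartite]. *)
Definition sparse_below n := forall A S D K, #|D| + #|S| < n -> bip A S D ->
  even_drawing D K -> 3 <= #|S| -> #|D| + 4 <= 2 * #|S|.

(** If the two parts overlap in t vertices that span u edges, adding up their
    bounds gives |D| + u + 8 <= 2 (|S| + t), which is good enough when
    2 t <= u + 4. The case of interest is a path of length two, t = 3, u = 2. *)
Lemma split_sparse n A S D K (S1 S2 : {set V}) : sparse_below n ->
  #|D| + #|S| <= n -> bip A S D -> even_drawing D K ->
  S1 \proper S -> S2 \proper S -> 3 <= #|S1| -> 3 <= #|S2| ->
  D \subset setX S1 S1 :|: setX S2 S2 ->
  2 * #|S1 :&: S2| <= #|D :&: setX (S1 :&: S2) (S1 :&: S2)| + 4 ->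
  #|D| + 4 <= 2 * #|S|.
Proof.
move=> IH ltn bD ev pS1 pS2 S13 S23 sD cS.
have part (S' : {set V}) : S' \proper S -> 3 <= #|S'| ->
    #|D :&: setX S' S'| + 4 <= 2 * #|S'|.
  move=> pS S'3; apply: (IH A _ _ K) => //.
  - apply: leq_trans ltn; rewrite -addnS; apply: leq_add; last exact: proper_card.
    by apply/subset_leq_card/subsetIl.
  - apply/subsetP => -[x y]; rewrite !inE /= => /andP [/(bipP bD) [_ xA _ yA]].
    by rewrite xA yA !andbT.
  by apply: even_drawingS ev; apply: subsetIl.
have := part _ pS1 S13; have := part _ pS2 S23.
have eD : D = (D :&: setX S1 S1) :|: (D :&: setX S2 S2).
  by rewrite -setIUr; apply/esym/setIidPl.
have := cardsUI (D :&: setX S1 S1) (D :&: setX S2 S2); rewrite -eD.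
have -> : (D :&: setX S1 S1) :&: (D :&: setX S2 S2) =
    D :&: setX (S1 :&: S2) (S1 :&: S2).
  by apply/setP => -[x y]; rewrite !inE /=; do 5 case: (_ \in _).
have := cardsUI S1 S2; have : #|S1 :|: S2| <= #|S|.
  by apply/subset_leq_card; rewrite subUset !proper_sub.
by move: cS; lia.
Qed.

(** Here b has exactly the neighbours a1, a2, a3, the vertices d and d' are
    further common neighbours of a1 and a2, and X is the component of a3 once
    these five vertices are removed. If X has no edge to d', then X and b are
    attached to the rest of the graph only through the path a1 d a2. *)
Lemma link_or_split n A S D K a1 a2 a3 b d d' :
  let F := [set a1; a2; b] :|: [set d; d'] in
  let X := [set x | connect (off D F) a3 x] in
  sparse_below n -> #|D| + #|S| <= n -> bip A S D -> even_drawing D K ->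
  [set a | (a, b) \in D] = [set a1; a2; a3] ->
  [/\ a1 != a2, a2 != a3 & a3 != a1] ->
  [/\ d != b, (a1, d) \in D & (a2, d) \in D] ->
  [/\ d' != b, (a1, d') \in D & (a2, d') \in D] -> d != d' ->
  #|D| + 4 <= 2 * #|S| \/ [/\ X :&: F = set0 & exists2 x, x \in X & (x, d') \in D].
Proof.
move=> F X IH ltn bD ev eN [a12 a23 a31] [db a1d a2d] [d'b a1d' a2d'] dd'.
have inN a : (a, b) \in D = [|| a == a1, a == a2 | a == a3].
  by rewrite orbA -!in_set1 -!in_setU -eN inE.
have [a1b a2b a3b] : [/\ (a1, b) \in D, (a2, b) \in D & (a3, b) \in D].
  by rewrite !inN !eqxx !orbT.
have [a1S a1A bS bA] := bipP bD a1b; have [a2S a2A _ _] := bipP bD a2b.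
have [a3S a3A _ _] := bipP bD a3b.
have [_ _ dS dA] := bipP bD a1d; have [_ _ d'S d'A] := bipP bD a1d'.
have neqA u v : u \in A -> v \notin A -> u != v.
  by move=> uA; apply: contraNneq => <-.
have XF x : x \in X -> x \notin F.
  rewrite inE => /connectP [p]; elim/last_ind: p => [_ ->|p y _].
    by rewrite !inE !negb_or a31 (eq_sym a3) a23 !neqA.
  by rewrite rcons_path last_rcons => /andP [_ /and3P [_ _ yF]] ->.
have [link|] := boolP [exists x in X, (x, d') \in D].
  right; split; last exact/exists_inP.
  by apply/setP => x; rewrite in_setI in_set0; apply/andP => -[/XF/negPf ->].
rewrite negb_exists_in => /forall_inP nadj; left.
pose S1 := b |: (X :|: [set a1; a2; d]).
pose S2 := S :\: (b |: X).
have Xstep x y : x \in X -> ((x, y) \in D) || ((y, x) \in D) ->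
    y \notin F -> y \in X.
  move=> xX xy yF; move: (xX); rewrite !inE => /connect_trans; apply.
  by apply: connect1; apply/and3P; split=> //; apply: XF.
have XS x : x \in X -> x \in S.
  rewrite inE => /connectP [p]; elim/last_ind: p => [_ -> //|p y _].
  rewrite rcons_path last_rcons => /andP [_ /and3P [+ _ _]] ->.
  by case/orP=> /(bipP bD) [].
have a3X : a3 \in X by rewrite inE connect0.
have [a1F a2F bF dF d'F] : [/\ a1 \in F, a2 \in F, b \in F, d \in F & d' \in F].
  by split; rewrite !inE eqxx ?orbT.
have nX x : x \in F -> x \notin X.
  by move=> xF; apply/negP => /XF; rewrite xF.
have [nXa1 nXa2 nXb nXd nXd'] : [/\ a1 \notin X, a2 \notin X, b \notin X,
    d \notin X & d' \notin X] by split; apply: nX.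
have inI x : x \in [set a1; a2; d] -> x \in S -> x != b -> x \notin X ->
    x \in S1 :&: S2.
  move=> x3 xS xb xX; rewrite in_setI in_setD.
  rewrite [x \in S1]in_setU1 [x \in b |: _]in_setU1.
  by rewrite in_setU x3 xS (negPf xX) (negPf xb) orbT.
have sIT : [set a1; a2; d] \subset S1 :&: S2.
  apply/subsetP => x x3; have /or3P x3' : [|| x == a1, x == a2 | x == d].
    by move: x3; rewrite !inE -orbA.
  by apply: inI => //; case: x3' => /eqP -> //; apply: neqA.
have sTI : S1 :&: S2 \subset [set a1; a2; d].
  apply/subsetP => x; rewrite in_setI in_setD !in_setU1.
  rewrite [x \in _ :|: [set a1; a2; d]]in_setU.
  by case: (x == b) => //=; case: (x \in X); rewrite ?andbF //= => /andP [].
have eI : S1 :&: S2 = [set a1; a2; d].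
  by apply/eqP; rewrite eqEsubset sIT sTI.
have cI : #|S1 :&: S2| = 3.
  by rewrite eI setUC cardsU1 cards2 !inE negb_or a12 !(eq_sym d) !neqA.
apply: (split_sparse (S1 := S1) (S2 := S2) IH ltn bD ev).
- apply/properP; split; last exists d' => //.
    apply/subsetP => x; rewrite !in_setU1 !in_setU => /or3P [/eqP -> //|/XS //|].
    by rewrite !inE -orbA => /or3P [] /eqP ->.
  rewrite in_setU1 in_setU (negPf d'b) (negPf nXd') !inE !negb_or.
  have [n1 n2] := (neqA _ _ a1A d'A, neqA _ _ a2A d'A).
  by rewrite !(eq_sym d') n1 n2 dd'.
- apply/properP; split; first exact: subsetDl.
  by exists b; rewrite // in_setD in_setU1 eqxx.
- by rewrite -cI; apply/subset_leq_card/subsetIl.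
- by rewrite -cI; apply/subset_leq_card/subsetIr.
- apply/subsetP => -[x y] xyD; rewrite in_setU !in_setX.
  have [xA yA] : x \in A /\ y \notin A by case: (bipP bD xyD).
  have [xS yS] : x \in S /\ y \in S by case: (bipP bD xyD).
  have xb : x != b by apply: neqA.
  have inS1 v : v \in S1 = [|| v == b, v \in X, v == a1, v == a2 | v == d].
    by rewrite in_setU1 in_setU !inE -!orbA.
  have inS2 v : v \in S2 = [&& v != b, v \notin X & v \in S].
    by rewrite in_setD in_setU1 negb_or -andbA.
  rewrite !inS1 !inS2 xS yS (negPf xb) /= !andbT.
  have [yb|yb] /= := eqVneq y b.
    move: xyD; rewrite yb inN andbT andbF orbF => /or3P xN.
    by case: xN => [->|->|/eqP ->]; rewrite ?a3X /= ?orbT.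
  have [xX|xX] /= := boolP (x \in X).
    have [yF|yF] := boolP (y \in F); last first.
      by rewrite (Xstep x) ?xyD.
    move: yF; rewrite in_setU !inE -!orbA (negPf yb) /= => /or4P [] /eqP ey.
    - by rewrite ey a1A in yA.
    - by rewrite ey a2A in yA.
    - by rewrite ey eqxx !orbT.
    by case/negP: (nadj x xX); rewrite -ey.
  have [yX|yX] /= := boolP (y \in X); last by rewrite orbT.
  have [xF|xF] := boolP (x \in F); last first.
    by rewrite (Xstep y x) ?xyD ?orbT in xX.
  move: xF; rewrite in_setU !inE -!orbA (negPf xb) /= => /or4P [] /eqP ex.
  - by rewrite ex eqxx.
  - by rewrite ex eqxx orbT.
  - by rewrite -ex xA in dA.
  by rewrite -ex xA in d'A.
rewrite cI eI (leq_add2r 4 2); apply/card_gt1P; exists (a1, d), (a2, d).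
split; last by rewrite xpair_eqE eqxx andbT.
- by rewrite in_setI in_setX a1d !inE !eqxx !orbT.
by rewrite in_setI in_setX a2d !inE !eqxx !orbT.
Qed.

(** A vertex of degree at most 2 can be deleted. At a vertex b of degree 3 the
    three cases of the opening comment apply: identification, splitting, and
    K_{3,3}. *)
Lemma no_low_vertex n A S D K b : sparse_below n ->
  #|D| + #|S| <= n -> bip A S D -> even_drawing D K ->
  #|D| + 3 = 2 * #|S| -> 5 <= #|S| -> b \in S -> b \notin A ->
  #|[set p in D | p.2 == b]| <= 3 -> False.
Proof.
move=> IH ltn bD ev cD cS bS bA.
have cSb : #|S| = #|S :\ b|.+1 by rewrite (cardsD1 b) bS.
rewrite leq_eqVlt => /orP [/eqP|]; last first.
  rewrite ltnS => low; set F := [set p in D | _] in low.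
  have := cardsID F D; have := subset_leq_card (subsetIr D F) => leF cDF.
  suff : #|D :\: F| + 4 <= 2 * #|S :\ b|.
    by move: leF cDF low cSb cD; clear; lia.
  apply: (IH A _ _ K); last by move: cS cSb; clear; lia.
  - by move: leF cDF ltn cSb; clear; lia.
  2: by apply: even_drawingS ev; apply: subsetDl.
  apply/subsetP => -[x y]; rewrite !inE /= negb_and => /andP [+ xyD].
  rewrite xyD /=; have [-> -> -> ->] := bipP bD xyD => ->; rewrite !andbT /=.
  by apply: contraNneq bA => <-; case: (bipP bD xyD).
rewrite card_fiber2; set N := [set a | (a, b) \in D] => cN.
have [a1 [a2 [a3 [[a1N a2N a3N] [a12 a23 a31]]]]] : exists a1 a2 a3 : V,
    [/\ a1 \in N, a2 \in N & a3 \in N] /\ [/\ a1 != a2, a2 != a3 & a3 != a1].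
  by apply/card_gt2P; rewrite cN.
have eN : N = [set a1; a2; a3].
  apply/esym/eqP; rewrite eqEcard cN !subUset !sub1set a1N a2N a3N /=.
  by rewrite setUC cardsU1 cards2 !inE negb_or a12 a31 (eq_sym a3) a23.
move: (a1N) (a2N) (a3N); rewrite !inE => a1b a2b a3b.
have [a2S a2A _ _] := bipP bD a2b.
pose C := [set y | ((a1, y) \in D) && ((a2, y) \in D)].
have bC : b \in C by rewrite inE a1b.
have [C2|C3] := leqP #|C| 2.
  have := card_merge a12 a1b a2b; rewrite -/C -/N cN => cM.
  have ba2 : a2 != b by apply: contraNneq bA => <-.
  have cSb2 : #|S :\ b| = #|S :\ b :\ a2|.+1.
    by rewrite (cardsD1 a2 (S :\ b)) !inE ba2 a2S.
  suff : #|merge D a1 a2 b| + 4 <= 2 * #|S :\ b :\ a2|.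
    move: cM C2 cSb cSb2 cD; move: #|S :\ b :\ a2| #|S :\ b| #|S| #|D| #|C|.
    by move: #|merge _ _ _ _|; clear; lia.
  have leM := leq_card_merge D a1 a2 b.
  apply: (IH A _ _ (Kmerge D K a1 a2 b)).
  - move: leM ltn cSb cSb2; move: #|S :\ b :\ a2| #|S :\ b| #|S| #|D|.
    by move: #|merge _ _ _ _|; clear; lia.
  3: by move: cS cSb cSb2; move: #|S :\ b :\ a2| #|S :\ b| #|S|; clear; lia.
  - exact: bip_merge.
  - exact: even_merge bD ev a12 a1b a2b.
have {C3} /card_gt1P [c [c' [cC c'C cc']]] : 1 < #|C :\ b|.
  by move: (cardsD1 b C) C3; rewrite bC; clear; lia.
have hc : [/\ c != b, (a1, c) \in D & (a2, c) \in D].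
  by move: cC; rewrite !inE => /and3P [].
have hc' : [/\ c' != b, (a1, c') \in D & (a2, c') \in D].
  by move: c'C; rewrite !inE => /and3P [].
have [cb a1c a2c] := hc; have [c'b a1c' a2c'] := hc'.
pose F := [set a1; a2; b] :|: [set c; c'].
pose X := [set x | connect (off D F) a3 x].
have large : ~ #|D| + 4 <= 2 * #|S| by move: cD; clear; lia.
have hN : [/\ a1 != a2, a2 != a3 & a3 != a1] by [].
have [//|[XF linkc']] := link_or_split IH ltn bD ev eN hN hc hc' cc'.
have linkc : exists2 x, x \in X & (x, c) \in D.
  have c'c : c' != c by rewrite eq_sym.
  have [//|[_ [x xX xc]]] := link_or_split IH ltn bD ev eN hN hc' hc c'c.
  by exists x; rewrite // /X /F (setUC [set c]).
have [bc bc'] : b != c /\ b != c' by rewrite !(eq_sym b).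
apply: (@no_even_K33 a1 a2 a3 b c c' K) => // [d d' dB d'B dd'|d dB].
  apply: ev => //.
  - by move: dB; rewrite !inE => /or3P [] /eqP ->.
  by move: d'B; rewrite !inE => /or3P [] /eqP ->.
have [x xX xd] : exists2 x, x \in X & (x, d) \in D.
  move: dB; rewrite !inE => /or3P [] /eqP -> //.
  by exists a3; rewrite // inE connect0.
have [T HT] : exists T : V -> bool, forall v w, (v, w) \in D -> v \in F ->
    w \in F -> T v (+) T w = pot K v w a3 (+) pot K v w x.
  by apply: connect_link ev _; rewrite inE in xX.
(* The virtual edge runs through X from a3 to x, then along the edge xd. *)
exists (fun v => T v (+) K x d v) => a d' aA d'B dd'.
have ad' : (a, d') \in D.
  by move: aA d'B; rewrite !inE => /orP [] /eqP -> /or3P [] /eqP ->.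
rewrite addbACA HT //; last 2 first.
- by move: aA; rewrite !inE => /orP [] ->; rewrite ?orbT.
- by move: d'B; rewrite !inE => /or3P [] ->; rewrite ?orbT.
rewrite (ev x d a d') //; last first.
  have aF : a \in F.
    by rewrite !inE; move: aA; rewrite !inE => /orP [] ->; rewrite ?orbT.
  apply/eqP => exa; have : x \in X :&: F by rewrite in_setI xX exa.
  by rewrite XF inE.
by case: (pot _ _ _ a3) (pot _ _ _ x) (pot _ _ _ d) => [] [] [].
Qed.

(** The constant 4 is best possible and the induction needs it: with a weaker
    bound the two parts in [split_sparse] would not add up. *)
Theorem sparse_even_bipartite A S D K : bip A S D -> even_drawing D K ->
  3 <= #|S| -> #|D| + 4 <= 2 * #|S|.
Proof.
move: {2}_.+1 (ltnSn (#|D| + #|S|)) => n; elim: n A S D K => [//|n IH] A S D K.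
rewrite ltnS => ltn bD ev S3; have {}IH : sparse_below n := IH.
(* Up to four vertices, counting pairs between the two sides is enough. *)
have [S4|S5] := leqP #|S| 4.
  have := card_bip bD; have := cardsID A S.
  move: S3 S4; move: #|S| #|S :&: A| #|S :\: A| #|D| => s i j k; clear.
  move=> s3 s4 ij; case: s s3 s4 ij => [|[|[|[|[|]]]]] // _ _.
    by case: i => [|[|[|[|]]]] //; case: j => [|[|[|[|]]]] //; lia.
  by case: i => [|[|[|[|[|]]]]] //; case: j => [|[|[|[|[|]]]]] //; lia.
rewrite leqNgt; apply/negP => ltSD.
(* A surplus edge could be deleted, so only one edge is in excess. *)
have eD : #|D| + 3 = 2 * #|S|.
  have [p pD] : exists p, p \in D.
    by apply/card_gt0P; move: ltSD S5; move: #|S| #|D|; clear; lia.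
  have cD := cardsD1 p D; rewrite pD in cD.
  have : #|D :\ p| + 4 <= 2 * #|S|.
    have subD : D :\ p \subset D by apply: subsetDl.
    apply: (IH A S _ K) => //.
    - by move: ltn; rewrite cD.
    - exact: subset_trans subD bD.
    exact: even_drawingS ev.
  by move: cD ltSD; move: #|S| #|D| #|D :\ p|; clear; lia.
have [v vS low] : exists2 v, v \in S &
    #|[set p in D | p.2 == v]| + #|[set p in D | p.1 == v]| <= 3.
  by apply: bip_low_degree bD _; move: eD S5; move: #|S| #|D|; clear; lia.
have [vA|vA] := boolP (v \in A); last first.
  apply: (no_low_vertex IH ltn bD ev eD S5 vS vA).
  exact: leq_trans (leq_addr _ _) low.
have cD' := card_swap D.
apply: (no_low_vertex (b := v) IH _ (bip_swap bD) (even_drawing_swap ev) _ S5 vS).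
- by rewrite cD'.
- by rewrite cD'.
- by rewrite inE vA.
apply: leq_trans low; apply: leq_trans (leq_addl _ _).
rewrite -(card_swap [set p in D | p.1 == v]); apply: subset_leq_card.
by apply/subsetP => -[x y]; rewrite !inE.
Qed.

End EvenDrawing.

(** * Parity of winding *)

Import Order.TTheory GRing.Theory Num.Theory.
Import numFieldNormedType.Exports.

Section Crossing.
Local Open Scope ring_scope.
Variable R : realType.
Implicit Types (z v : R * R) (p q : R -> R * R).

(** Negative in the order that compares second coordinates first: a half-open
    half plane, so that z and - z are never on the same side unless z = 0. *)
Definition lower z := (z.2 < 0) || (z.2 == 0) && (z.1 < 0).

(** Whether a step from z to z' crosses the positive first axis. This is only
    meaningful for steps that stay in one of the four half planes below; then a
    change of side with z on the right cannot pass on the left of 0. *)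
Definition cross z z' := (lower z (+) lower z') && (0 < z.1).

Definition half_plane (b s : bool) z :=
  let x := if b then z.1 else z.2 in if s then 0 < x else x < 0.

Lemma ex_half_plane z : z != 0 -> exists b s, half_plane b s z.
Proof.
case: z => x y; rewrite xpair_eqE negb_and => /orP [x0|y0].
  by exists true, (0 < x); rewrite /half_plane /=; case: ltgtP x0.
by exists false, (0 < y); rewrite /half_plane /=; case: ltgtP y0.
Qed.

Lemma lower_half_plane s z : half_plane false s z -> lower z = ~~ s.
Proof.
case: z => x y; rewrite /half_plane /lower /=; case: s => y0.
  by rewrite lt_gtF // gt_eqF.
by rewrite y0.
Qed.

(** In the half plane that contains the ray, crossings are changes of side; in
    the three others there are none. *)
Lemma cross_square b s z1 z2 z3 z4 :
  half_plane b s z1 -> half_plane b s z2 -> half_plane b s z3 ->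
  half_plane b s z4 ->
  cross z1 z2 (+) cross z2 z3 = cross z1 z4 (+) cross z4 z3.
Proof.
rewrite /cross; case: b => [|/lower_half_plane -> /lower_half_plane -> /lower_half_plane ->
  /lower_half_plane ->].
  rewrite /half_plane /=; case: s; last first.
    by move=> /lt_gtF-> /lt_gtF-> _ /lt_gtF->; rewrite !andbF.
  move=> -> -> _ ->; rewrite !andbT.
  by case: (lower z1) (lower z2) (lower z3) (lower z4) => [] [] [] [].
by rewrite addbb.
Qed.

Lemma lowerN z : z != 0 -> lower (- z) = ~~ lower z.
Proof.
case: z => x y; rewrite xpair_eqE /lower /= !oppr_lt0 oppr_eq0 negb_and.
by case: (ltgtP y 0) => //=; case: (ltgtP x 0).
Qed.

Lemma half_plane_neq0 b s z : half_plane b s z -> z != 0.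
Proof.
by apply: contraTneq => ->; rewrite /half_plane; case: b s => [] []; rewrite /= ltxx.
Qed.

(** After a half turn the positive axis becomes the negative one, so a step is
    counted on exactly one of the two sides precisely if it changes side. *)
Lemma crossN b s z z' : half_plane b s z -> half_plane b s z' ->
  cross (- z) (- z') = cross z z' (+) (lower z (+) lower z').
Proof.
move=> hz hz'; rewrite /cross !lowerN ?(half_plane_neq0 hz) ?(half_plane_neq0 hz') //=.
rewrite oppr_gt0 addbN addNb negbK; case: b hz hz'; last first.
  by move=> /lower_half_plane -> /lower_half_plane ->; rewrite addbb.
rewrite /half_plane; case: s => zs _; rewrite /= zs (lt_gtF zs).
  by case: (lower z) (lower z') => [] [].
by case: (lower z) (lower z') => [] [].
Qed.

Lemma grid_telescope (f g : nat -> nat -> bool) m n :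
  (forall i j, (i < m)%N -> (j < n)%N ->
     f i j (+) g i.+1 j = g i j (+) f i j.+1) ->
  (\big[addb/false]_(i < m) f i 0%N) (+) (\big[addb/false]_(j < n) g m j) =
  (\big[addb/false]_(j < n) g 0%N j) (+) (\big[addb/false]_(i < m) f i n).
Proof.
elim: n => [|n IHn] cell; first by rewrite !big_ord0 addbF.
rewrite !big_ord_recr /= addbA IHn; last first.
  by move=> i j im jn; apply: cell; rewrite // ltnW.
rewrite -!addbA; congr addb.
elim: m cell {IHn} => [|m IHm] cell; first by rewrite !big_ord0 addbF.
rewrite !big_ord_recr /= -addbA cell // addbA IHm -?addbA // => i j im jn.
by apply: cell; rewrite // ltnW.
Qed.

(** The parity of the number of crossings of p with a ray from v, sampled at N
    equal steps; only used when N is large enough for the drawing. *)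
Definition winding N p v : bool := \big[addb/false]_(i < N)
  cross (p (i%:R / N%:R) - v) (p (i.+1%:R / N%:R) - v).

Definition fine_grid N p q := forall i j, (i < N)%N -> (j < N)%N ->
  exists b s, forall i' j', (i <= i' <= i.+1)%N -> (j <= j' <= j.+1)%N ->
    half_plane b s (p (i'%:R / N%:R) - q (j'%:R / N%:R)).

(** The boundary of the grid of values p s - q t: the sides t = 0 and t = 1 are p
    seen from the ends of q, while the sides s = 0 and s = 1 are q seen from the
    ends of p up to a half turn, whence the terms in [lower]. *)
Lemma winding_swap N p q : (0 < N)%N -> fine_grid N p q ->
  winding N p (q 0) (+) winding N p (q 1) =
  (winding N q (p 0) (+) (lower (q 0 - p 0) (+) lower (q 1 - p 0))) (+)
  (winding N q (p 1) (+) (lower (q 0 - p 1) (+) lower (q 1 - p 1))).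
Proof.
move=> N0 fg.
pose w i j := p (i%:R / N%:R) - q (j%:R / N%:R).
have NN : N%:R / N%:R = 1 :> R by rewrite divff // pnatr_eq0 -lt0n.
have := @grid_telescope (fun i j => cross (w i j) (w i.+1 j))
  (fun i j => cross (w i j) (w i j.+1)) N N.
have -> : \big[addb/false]_(i < N) cross (w i 0%N) (w i.+1 0%N) =
    winding N p (q 0) by apply: eq_bigr => i _; rewrite /w mul0r.
have -> : \big[addb/false]_(i < N) cross (w i N) (w i.+1 N) =
    winding N p (q 1) by apply: eq_bigr => i _; rewrite /w NN.
have col k : (k <= N)%N -> \big[addb/false]_(j < N) cross (w k j) (w k j.+1) =
   winding N q (p (k%:R / N%:R)) (+) (lower (q 0 - p (k%:R / N%:R)) (+)
     lower (q 1 - p (k%:R / N%:R))).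
  move=> kN; set v := p _.
  have -> : lower (q 0 - v) (+) lower (q 1 - v) = \big[addb/false]_(j < N)
      (lower (q (j%:R / N%:R) - v) (+) lower (q (j.+1%:R / N%:R) - v)).
    have tele m : lower (q 0 - v) (+) lower (q (m%:R / N%:R) - v) =
        \big[addb/false]_(j < m) (lower (q (j%:R / N%:R) - v) (+)
          lower (q (j.+1%:R / N%:R) - v)).
      elim: m => [|m IHm]; first by rewrite big_ord0 mul0r addbb.
      by rewrite big_ord_recr /= -IHm addbA addbK.
    by rewrite -tele NN.
  rewrite -big_split /=; apply: eq_bigr => j _.
  have [b [s hp]] : exists b s,
      half_plane b s (w k j) && half_plane b s (w k j.+1).
    (* The last column belongs to the cells on its left. *)
    case: k kN @v => [|k] kN v.
      have [b [s hp]] := fg 0%N j N0 (ltn_ord j).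
      by exists b, s; apply/andP; split; apply: hp; rewrite ?leqnn ?leqnSn.
    have [b [s hp]] := fg k j kN (ltn_ord j).
    by exists b, s; apply/andP; split; apply: hp; rewrite ?leqnn ?leqnSn.
  case/andP: hp => h1 h2; have := crossN h1 h2.
  rewrite /w -/v !opprB => ->; rewrite -addbA -[LHS]addbF; congr addb.
  rewrite -!(opprB v) !lowerN ?(half_plane_neq0 h1) ?(half_plane_neq0 h2) //.
  by rewrite addbN addNb negbK addbb.
have c0 := col 0%N isT; have cN := col N (leqnn N).
rewrite mul0r in c0; rewrite NN in cN; rewrite c0 cN => tele.
have xor_swap a b c d : a (+) c = d (+) b -> a (+) b = d (+) c.
  by case: a b c d => [] [] [] [].
apply/xor_swap/tele => i j iN jN; have [b [s hp]] := fg i j iN jN.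
by apply: (cross_square (b := b) (s := s)); apply: hp; rewrite ?leqnn ?leqnSn.
Qed.

Local Open Scope classical_set_scope.
Local Open Scope ring_scope.
Lemma within_coord p s (e : R) : {within `[0, 1]%classic, continuous p} ->
  s \in `[0, 1] -> 0 < e -> exists2 d, 0 < d & forall t, t \in `[0, 1] ->
    `|s - t| < d -> `|(p s).1 - (p t).1| < e /\ `|(p s).2 - (p t).2| < e.
Proof.
move=> /subspace_continuousP cp s01 e0.
have /cvg_ballP /(_ e e0) := cp s s01.
rewrite -nbhs_nearE => /nbhs_ballP [d /= d0 H]; exists d => // t t01 std.
by have [] := H t std t01.
Qed.

Lemma half_plane_near p q s t : {within `[0, 1]%classic, continuous p} ->
  {within `[0, 1]%classic, continuous q} -> s \in `[0, 1] -> t \in `[0, 1] ->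
  p s != q t -> exists b sg, exists2 d, 0 < d & forall s' t',
    s' \in `[0, 1] -> t' \in `[0, 1] -> `|s - s'| < d -> `|t - t'| < d ->
    half_plane b sg (p s' - q t').
Proof.
move=> cp cq s01 t01; rewrite -subr_eq0 => /ex_half_plane [b [sg hp]].
exists b, sg.
pose c (z : R * R) := if b then z.1 else z.2.
have cB z z' : c (z - z') = c z - c z' by rewrite /c; case: (b).
have hpE z : half_plane b sg z = (if sg then 0 < c z else c z < 0) by [].
pose e := `|c (p s) - c (q t)| / 2.
have e0 : 0 < e.
  rewrite divr_gt0 // normr_gt0 -cB.
  by move: hp; rewrite hpE; case: (sg) => [/gt_eqF ->|/lt_eqF ->].
have [d1 d10 H1] := within_coord cp s01 e0.
have [d2 d20 H2] := within_coord cq t01 e0.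
exists (Num.min d1 d2) => [|s' t' s'01 t'01]; first by rewrite lt_min d10.
rewrite !lt_min => /andP [ss' _] /andP [_ tt'].
have cs : `|c (p s) - c (p s')| < e by rewrite /c; case: (b); case: (H1 _ s'01 ss').
have ct : `|c (q t) - c (q t')| < e by rewrite /c; case: (b); case: (H2 _ t'01 tt').
move: hp cs ct; rewrite !hpE !cB /e; case: (sg) => hp.
  by rewrite (gtr0_norm hp) !ltr_norml => /andP [_ cs] /andP [ct _]; lra.
by rewrite (ltr0_norm hp) !ltr_norml => /andP [cs _] /andP [_ ct]; lra.
Qed.

(** The nonzero values p s - q t have neighbourhoods that lie in a half plane, and
    by compactness of the square one step size works for all of them. *)
Lemma near_fine_grid p q : {within `[0, 1]%classic, continuous p} ->
  {within `[0, 1]%classic, continuous q} ->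
  (forall s t : R, s \in `[0, 1] -> t \in `[0, 1] -> p s != q t) ->
  \forall N \near \oo, fine_grid N p q.
Proof.
move=> cp cq pq.
pose K : set (R * R) := `[0 : R, 1] `*` `[0 : R, 1].
pose P (N : nat) (x : R * R) := exists b s, forall y : R * R, K y ->
  `|x.1 - y.1| <= N%:R^-1 -> `|x.2 - y.2| <= N%:R^-1 ->
  half_plane b s (p y.1 - q y.2).
have cK : compact K by apply: compact_setX; apply: segment_compact.
have cov : \forall N \near \oo, K `<=` P N.
  have /compact_near_coveringP := cK; apply => -[s t] [/= s01 t01].
  have [|b [sg [d d0 H]]] := half_plane_near cp cq s01 t01; first exact: pq.
  have d20 : 0 < d / 2 by rewrite divr_gt0.
  exists (ball (s, t) (d / 2), [set N : nat | N%:R^-1 < d / 2]) => /=.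
    split; first exact: nbhsx_ballx.
    have := nbhs_infty_gtr (d / 2)^-1; apply: filterS => N dN /=.
    by rewrite invf_plt ?posrE // (lt_trans _ dN) ?invr_gt0.
  move=> [[s' t'] N] /= [[/= ss' tt'] Nd]; exists b, sg => -[u v] /= [u01 v01] su tv.
  apply: H => //; rewrite (splitr d).
    by rewrite (le_lt_trans (ler_distD s' _ _)) // ltrD // (le_lt_trans su).
  by rewrite (le_lt_trans (ler_distD t' _ _)) // ltrD // (le_lt_trans tv).
near=> N => i j iN jN.
have N0 : (0 < N)%N by apply: leq_trans iN.
have sub : K `<=` P N by near: N.
have in01 k : (k <= N)%N -> (k%:R / N%:R : R) \in `[0, 1].
  move=> kN; rewrite in_itv /= divr_ge0 //= ler_pdivrMr ?ltr0n //.
  by rewrite mul1r ler_nat.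
have step k k' : (k <= k' <= k.+1)%N ->
    `|k%:R / N%:R - k'%:R / N%:R| <= N%:R^-1 :> R.
  rewrite -mulrBl normrM [X in _ * X]ger0_norm ?invr_ge0 // => /andP [].
  rewrite leq_eqVlt => /orP [/eqP -> _|kk' k'k].
    by rewrite subrr normr0 mul0r invr_ge0 // ler0n.
  have -> : k' = k.+1 by apply/eqP; rewrite eqn_leq k'k.
  by rewrite distrC -natrB ?leqnSn // subSnn normr1 mul1r.
have [|b [s H]] := sub (i%:R / N%:R, j%:R / N%:R).
  by split; apply: in01; apply: ltnW.
exists b, s => i' j' ii' jj'; apply: (H (_, _)); rewrite /= ?step //.
case/andP: ii' => _ ii'; case/andP: jj' => _ jj'.
by split; apply: in01; [exact: leq_trans iN | exact: leq_trans jN].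
Unshelve. all: end_near.
Qed.
End Crossing.

(** * From planar drawings to even drawings *)

Definition arcs_from (G : sgraph) (A : {set G}) : {set G * G} :=
  [set p | adj p.1 p.2 & (p.1 \in A) && (p.2 \notin A)].

Section PlanarCrossing.
Local Open Scope classical_set_scope.
Local Open Scope ring_scope.

(** L compares the positions of vertices, and K is the winding parity of the arcs,
    all sampled with the same number of steps. Arcs of disjoint edges do not
    meet, as a common point would be a common end. *)
Lemma planar_even_drawing (R : realType) (G : sgraph) (A : {set G}) :
  planar R G -> exists (L : G -> G -> bool) (K : G -> G -> G -> bool),
    (forall u v, u != v -> L v u = ~~ L u v) /\ even_drawing L (arcs_from A) K.
Proof.
move=> [pos [gam [posI arcs thru meet]]].
have /boolp.choice [g Hg] : forall e : G * G, exists p : R -> R * R, adj e.1 e.2 ->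
    [/\ {within `[0, 1]%classic, continuous p}, p 0 = pos e.1,
        p 1 = pos e.2 & forall t, t \in `[0, 1] -> gam e.1 e.2 (p t)].
  move=> [x y] /=; have [axy|nxy] := boolP (adj x y); last by exists (fun=> 0).
  have [[p [cp _ p0 p1 pE]] _] := arcs _ _ axy; exists p => _; split=> // t t01.
  by rewrite pE; exists t.
pose crossfree (e f : G * G) :=
  [&& e \in arcs_from A, f \in arcs_from A, e.1 != f.1 & e.2 != f.2].
have fineN : \forall N \near \oo, forall ef : (G * G) * (G * G),
    crossfree ef.1 ef.2 -> fine_grid N (g ef.1) (g ef.2).
  apply: filter_forall => -[[a b] [c d]] /=.
  have [/and4P [] |] := boolP (crossfree (a, b) (c, d)); last by move=> _; near=> N.
  rewrite !inE /= => /and3P [ab aA bA] /and3P [cd cA dA] ac bd.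
  have [cg1 _ _ im1] := Hg (a, b) ab; have [cg2 _ _ im2] := Hg (c, d) cd.
  have neqA u v : u \in A -> v \notin A -> u != v.
    by move=> uA; apply: contraNneq => <-.
  have := near_fine_grid cg1 cg2; move=> /(_ _)/filterS; apply => // s t s01 t01.
  apply/eqP => est; have := im2 _ t01; rewrite -est => /= in2.
  have /= in1 := im1 _ s01.
  have [||z ez] := meet _ _ _ _ ab cd _ _ _ in1 in2.
  - by move=> [ca _]; rewrite ca eqxx in ac.
  - by move=> [cb _]; move: bA; rewrite -cb cA.
  rewrite ez in in1 in2.
  have [zc|zd] := thru _ _ _ cd in2; have [za|zb] := thru _ _ _ ab in1.
  - by rewrite -za -zc eqxx in ac.
  - by move: bA; rewrite -zb zc cA.
  - by move: dA; rewrite -zd za aA.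
  by rewrite -zb -zd eqxx in bd.
have [N [N0 fN]] : exists N, (0 < N)%N /\ forall ef : (G * G) * (G * G),
    crossfree ef.1 ef.2 -> fine_grid N (g ef.1) (g ef.2).
  have : \forall N \near \oo, (0 < N)%N /\ forall ef : (G * G) * (G * G),
    crossfree ef.1 ef.2 -> fine_grid N (g ef.1) (g ef.2).
    by near=> N; split; near: N => //; exact: nbhs_infty_gt.
  exact: filter_ex.
exists (fun u v => lower (pos u - pos v)), (fun a b v => winding N (g (a, b)) (pos v)).
split=> [u v uv|a b c d abA cdA ac bd].
  by rewrite -(opprB (pos u)) lowerN // subr_eq0 (inj_eq posI).
have adjA p : p \in arcs_from A -> adj p.1 p.2 by rewrite inE => /andP [].
have [_ /= ga gb _] := Hg (a, b) (adjA _ abA).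
have [_ /= gc gd _] := Hg (c, d) (adjA _ cdA).
have := winding_swap N0 (fN ((a, b), (c, d)) _).
by rewrite ga gb gc gd; apply; apply/and4P.
Unshelve. all: end_near.
Qed.

End PlanarCrossing.

(** * The orientation *)

(** Removing at most two neighbours of v would isolate v. *)
Lemma min_degree3 (G : sgraph) (v : G) : k_connected 3 G ->
  2 < #|[set u | adj v u]|.
Proof.
move=> [n3 conn]; rewrite ltnNge; apply/negP => deg2.
set X := [set u | adj v u] in deg2.
have vX : v \notin X by rewrite inE adj_irr.
have [y yX] : exists y, y \notin v |: X.
  apply/existsP; rewrite -negb_forall; apply/negP => /forallP all_in.
  have : #|G| <= #|v |: X| by rewrite -cardsT; apply/subset_leq_card/subsetP=> z _.
  by rewrite cardsU1 vX leqNgt (leq_ltn_trans _ n3) // add1n ltnS.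
move: yX; rewrite in_setU1 negb_or => /andP [yv yX].
have /connectP [[|z s] /=] := conn X deg2 v y vX yX.
  by move=> _ ey; rewrite ey eqxx in yv.
by case/andP=> /and3P [vz _]; rewrite inE vz.
Qed.

Theorem corollary4 (R : realType) (G : sgraph) :
  k_connected 3 G -> bipartite G -> planar R G ->
  (proper_orientation_number G <= 3)%N.
Proof.
move=> conn [A bipA] plG; pose E := arcs_from A.
have [L [K [Lanti ev]]] := planar_even_drawing A plG.
have in_E a b : ((a, b) \in E) = [&& adj a b, a \in A & b \notin A] by rewrite inE.
have sparse (S : {set G}) : #|E :&: setX S S| <= 2 * #|S|.
  have bipS : bip A S (E :&: setX S S).
    apply/subsetP => -[a b]; rewrite in_setI in_E !in_setX in_setI in_setD.
    by case/and3P => /and3P [_ -> ->] -> ->.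
  have [S2|S3] := leqP #|S| 2; last first.
    apply: leq_trans (sparse_even_bipartite Lanti bipS _ S3); first exact: leq_addr.
    by apply: even_drawingS ev; apply: subsetIl.
  have := card_bip bipS; rewrite -(cardsID A S) in S2 *; move: S2.
  move: #|_ :&: setX _ _| #|S :&: A| #|S :\: A| => e i j; clear; nia.
have degA a : a \in A -> 3 <= #|[set b | (a, b) \in E]|.
  move=> aA; have := min_degree3 a conn; congr (_ < _); apply: eq_card => b.
  rewrite !inE aA /=; have [/bipA|] //= := boolP (adj a b).
  by rewrite aA; case: (b \in A).
have bipE a b : (a, b) \in E -> (a \in A) && (b \notin A).
  by rewrite in_E => /and3P [_ -> ->].
have [F [FE F3 F2]] := ex_forced_orientation bipE degA sparse (leqnSn 2).
pose D := [set p : G * G | adj p.1 p.2 &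
  if p.1 \in A then p \notin F else (p.2, p.1) \in F].
have indA a : a \in A -> indegree D a = 3.
  move=> aA; rewrite -(F3 a aA); apply: eq_card => u; rewrite !inE /= adj_sym.
  have [auF|auF] := boolP ((a, u) \in F).
    have := subsetP FE _ auF; rewrite in_E => /and3P [-> _ uA].
    by rewrite (negPf uA).
  have [/bipA|] //= := boolP (adj a u); rewrite aA.
  by case: (u \in A).
have indB b : b \notin A -> indegree D b <= 2.
  move=> bA; apply: leq_trans (F2 b); apply: subset_leq_card.
  apply/subsetP => u; rewrite !inE /= => /andP [ub]; have := bipA _ _ ub.
  by rewrite ub (negPf bA); case: ifP => //= _ _ ->.
suff : has_proper_orientation G 3.
  by move=> h; rewrite /proper_orientation_number; case: ex_minnP => n _; apply.
apply/existsP; exists D; apply/and3P; split.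
- apply/forallP => x; apply/forallP => y; rewrite !inE /= (adj_sym y x).
  have [/bipA|] //= := boolP (adj x y).
  by case: (x \in A); case: (y \in A) => //= _; case: (_ \in F).
- apply/forallP => x; apply/forallP => y; apply/implyP => /bipA.
  have [xA|xA] := boolP (x \in A); have [yA|yA] := boolP (y \in A) => // _.
    by rewrite (indA x) // gtn_eqF // ltnS indB.
  by rewrite (indA y) // ltn_eqF // ltnS indB.
apply/forallP => v; have [vA|vA] := boolP (v \in A); first by rewrite indA.
by rewrite ltnW // ltnS indB.
Qed.
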